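(* Let $N_1,N_2,\dots$ be positive integers with $N_k\mid N_{k+1}$ for all $k$, and let $d_1,d_2,\dots$ be positive integers. Suppose $f_1,f_2,\dots$ are trigonometric polynomials on $\mathbb{T}$ such that $\deg f_k\le d_k$ and $f_k$ is $\frac{2\pi}{N_k}$-periodic. Then \[(1-C\theta)\|(f_k)\|_{\mathrm{ind}}\le\|(f_k)\|_{L^1(\ell^2)}\le(1+C\theta)\|(f_k)\|_{\mathrm{ind}},\] where $\theta=\sup_k\frac{d_k}{N_{k+1}}$ and $C$ is a numerical constant.
   Context: $\mathbb{T}=\mathbb{R}/2\pi\mathbb{Z}$ with normalized Lebesgue measure $\mu$. $\|(g_k)\|_{L^1(\ell^2)}=\int_{\mathbb{T}}(\sum_k|g_k|^2)^{1/2}d\mu$ and $\|(g_k)\|_{\mathrm{ind}}=\int_{\mathbb{T}^\infty}(\sum_k|g_k(t_k)|^2)^{1/2}d(\mu\otimes\mu\otimes\cdots)(t_1,t_2,\dots)$. *)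

(* Defs.v *)
From HB Require Import structures.
From mathcomp Require Import all_boot all_order all_algebra.
From mathcomp Require Import complex.
From mathcomp Require Import all_classical all_reals all_analysis.
Set Implicit Arguments. Unset Strict Implicit. Unset Printing Implicit Defensive.
Import Order.TTheory GRing.Theory Num.Theory.
Local Open Scope classical_set_scope.
Local Open Scope ring_scope.

(* The torus T = R / 2piZ is represented by 2pi-periodic functions on R;
   the normalized Haar measure on T is (2pi)^-1 * Lebesgue on [0, 2pi]. *)

(* T^infty, represented as sequences of reals (coordinates in R, read mod 2pi) *)
Definition seqR (R : realType) := nat -> R.
HB.instance Definition _ (R : realType) := gen_eqMixin (seqR R).
HB.instance Definition _ (R : realType) := gen_choiceMixin (seqR R).
HB.instance Definition _ (R : realType) := isPointed.Build (seqR R) (fun _ => 0%R).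

Section Defs.
Variable R : realType.

Definition expi (x : R) : R[i] := (cos x +i* sin x)%C.

Definition sqmod (z : R[i]) : R := complex.Re z ^+ 2 + complex.Im z ^+ 2.

Definition trig_poly_deg_le (d : nat) (f : R -> R[i]) : Prop :=
  exists c : int -> R[i], forall t : R,
    f t = \sum_(j < (2 * d).+1) c (j%:Z - d%:Z) * expi ((j%:Z - d%:Z)%:~R * t).

Definition sqrte (x : \bar R) : \bar R :=
  match x with
  | r%:E => (Num.sqrt r)%:E
  | +oo%E => +oo%E
  | -oo%E => 0%E
  end.

Definition I2pi : set R := `[0, 2 * pi]%classic.

Definition muT (A : set R) : \bar R :=
  (((2 * pi)^-1)%:E * lebesgue_measure (A `&` I2pi))%E.

Definition l2_at (g : nat -> R[i]) : \bar R :=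
  sqrte (\sum_(0 <= k <oo) (sqmod (g k))%:E)%E.

Definition L1l2_norm (g : nat -> R -> R[i]) : \bar R :=
  (((2 * pi)^-1)%:E *
     \int[lebesgue_measure]_(t in I2pi) l2_at (fun k => g k t))%E.

Definition cylinders : set (set (seqR R)) :=
  [set B | exists k (A : set R), measurable A /\ B = (fun t => t k) @^-1` A].

Definition Tinf := g_sigma_algebraType cylinders.

(* P is the infinite product measure mu (x) mu (x) ... on T^infty:
   its value on finite-dimensional rectangles is the product of the mu's.
   (Such a probability exists and is unique by Kolmogorov / pi-lambda.) *)
Definition is_infinite_product (P : probability Tinf R) : Prop :=
  forall (n : nat) (A : nat -> set R), (forall k, measurable (A k)) ->
    P [set t : Tinf | forall k, (k < n)%N -> A k (t k)] =
    (\prod_(k < n) muT (A k))%E.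

Definition ind_norm (P : probability Tinf R) (g : nat -> R -> R[i]) : \bar R :=
  (\int[P]_(t in [set: Tinf]) l2_at (fun k => g k (t k)))%E.

End Defs.

(* Main.v *)
From HB Require Import structures.
Require Import Defs.
From mathcomp Require Import all_boot all_order all_algebra.
From mathcomp Require Import complex.
From mathcomp Require Import all_classical all_reals all_analysis.
From mathcomp Require Import measurable_realfun ring lra zify.
Set Implicit Arguments. Unset Strict Implicit. Unset Printing Implicit Defensive.
Import Order.TTheory GRing.Theory Num.Theory.
Import numFieldNormedType.Exports.
Local Open Scope classical_set_scope.
Local Open Scope ring_scope.

(* Decouple one function at a time.  Put X_k = |f_k|^2 and, for fixed later
   variables, y = sum_{k > i} X_k(t_k) and A = sum_{k < i} X_k.  By concavity of
   the square root, the increment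
     h_b(t) = sqrt (A(t) + y + b) - sqrt (A(t) + y)
   lies between 0 and sqrt (y + b) - sqrt y.  For b > 0 it is an injective
   function of A, a trigonometric polynomial of degree at most
   2 max_{k < i} d_k <= 2 theta N_i, so that it takes each value at most
   4 theta N_i times per period unless it is constant.  Hence its sums over two
   translates of N_i equispaced points differ by at most
   4 theta N_i (sqrt (y + b) - sqrt y), and its mean over N_i equispaced points
   differs from its integral by at most 4 theta (sqrt (y + b) - sqrt y).
   As X_i is 2pi/N_i-periodic, taking b = X_i shows that replacing X_i(t) by
   X_i(t_i) changes the norm by at most
     4 theta E (sqrt (sum_{k >= i} X_k(t_k)) - sqrt (sum_{k > i} X_k(t_k))),
   and these errors telescope to 4 theta times the independent norm. *)

Section TrigonometricPolynomials.
Variable R : realType.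
Implicit Types (t x y : R) (z : R[i]) (d : nat) (f g : R -> R[i]).

Lemma expiD x y : expi (x + y) = expi x * expi y.
Proof. by rewrite /expi cosD sinD; simpc; congr (_ +i* _)%C; ring. Qed.

Lemma expi0 : expi (0 : R) = 1.
Proof. by rewrite /expi cos0 sin0. Qed.

Lemma expi_natr (n : nat) x : expi (n%:R * x) = expi x ^+ n.
Proof.
elim: n => [|n IHn]; first by rewrite mul0r expi0 expr0.
by rewrite -natr1 mulrDl mul1r expiD IHn exprSr.
Qed.

Lemma expi_neq0 x : expi x != 0.
Proof.
apply/eqP => e0; have := expiD x (- x).
by rewrite subrr expi0 e0 mul0r => /eqP; rewrite oner_eq0.
Qed.

Lemma conjc_expi x : ((expi x)^*)%C = expi (- x).
Proof. by rewrite /expi cosN sinN. Qed.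

Lemma expi_inj t x y : t <= x < t + 2 * pi -> t <= y < t + 2 * pi ->
  expi x = expi y -> x = y.
Proof.
wlog xy : x y / x <= y.
  move=> le_case hx hy exy; have [/le_case|/ltW/le_case] := leP x y; first exact.
  by move=> /(_ hy hx (esym exy)).
move=> /andP[tx _] /andP[_ yt] [ec es].
have cos_eq1 : cos (((y - x) / 2) *+ 2) = 1.
  by rewrite -mulr_natr divfK// cosB ec es -!expr2 cos2Dsin2.
have sin_eq0 : sin ((y - x) / 2) = 0.
  by apply/eqP; rewrite -sqrf_eq0; move: cos_eq1; rewrite cos_mulr2n cos2sin2; lra.
apply/eqP; rewrite eq_le xy /= leNgt; apply/negP => xlty.
suff : 0 < sin ((y - x) / 2) by rewrite sin_eq0 ltxx.
by apply: sin_gt0_pi; apply/andP; split; lra.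
Qed.

Lemma sqmod_mulc z : ((sqmod z)%:C)%C = z * (z^*)%C.
Proof. by case: z => a b; rewrite /sqmod /=; simpc; congr (_ +i* _)%C; ring. Qed.

Lemma sqmod_ge0 z : 0 <= sqmod z.
Proof. by rewrite addr_ge0 ?sqr_ge0. Qed.

Lemma trig_poly_deg_leP d f : trig_poly_deg_le d f <->
  exists2 q : {poly R[i]}, (size q <= (2 * d).+1)%N &
    forall t, f t * expi t ^+ d = q.[expi t].
Proof.
split=> [[c fE]|[q sq fq]].
  exists (\poly_(j < (2 * d).+1) c (j%:Z - d%:Z)) => [|t]; first exact: size_poly.
  rewrite fE horner_poly mulr_suml; apply: eq_bigr => j _.
  rewrite -mulrA -!expi_natr -expiD -mulrDl rmorphB /=.
  by rewrite -!pmulrn subrK.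
exists (fun n => q`_(`|n + d%:Z|)) => t.
apply: (mulIf (expf_neq0 d (expi_neq0 t))); rewrite fq (horner_coef_wide _ sq).
rewrite mulr_suml; apply: eq_bigr => j _.
rewrite subrK absz_nat -mulrA -!expi_natr -expiD -mulrDl rmorphB /=.
by rewrite -!pmulrn subrK.
Qed.

Lemma trig_poly_deg_leW d D f : (d <= D)%N ->
  trig_poly_deg_le d f -> trig_poly_deg_le D f.
Proof.
move=> dD /trig_poly_deg_leP[q sq fq]; apply/trig_poly_deg_leP.
exists (q * 'X^(D - d)) => [|t]; last first.
  by rewrite hornerM hornerXn -fq -mulrA -exprD subnKC.
by apply: leq_trans (size_polyMleq _ _) _; rewrite size_polyXn; lia.
Qed.

Lemma trig_poly_deg_leD d f g : trig_poly_deg_le d f -> trig_poly_deg_le d g ->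
  trig_poly_deg_le d (fun t => f t + g t).
Proof.
move=> /trig_poly_deg_leP[p sp fp] /trig_poly_deg_leP[q sq gq].
apply/trig_poly_deg_leP; exists (p + q) => [|t].
  by apply: leq_trans (size_polyD _ _) _; rewrite geq_max sp sq.
by rewrite mulrDl fp gq hornerD.
Qed.

Lemma trig_poly_deg_leM d d' f g : trig_poly_deg_le d f -> trig_poly_deg_le d' g ->
  trig_poly_deg_le (d + d') (fun t => f t * g t).
Proof.
move=> /trig_poly_deg_leP[p sp fp] /trig_poly_deg_leP[q sq gq].
apply/trig_poly_deg_leP; exists (p * q) => [|t].
  by apply: leq_trans (size_polyMleq _ _) _; lia.
by rewrite exprD mulrACA fp gq hornerM.
Qed.

Lemma trig_poly_deg_le_cst d (a : R[i]) : trig_poly_deg_le d (fun=> a).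
Proof.
apply: (trig_poly_deg_leW (leq0n d)); apply/trig_poly_deg_leP.
exists a%:P => [|t]; first exact: size_polyC_leq1.
by rewrite hornerC expr0 mulr1.
Qed.

Lemma trig_poly_deg_le_sum d n (f : nat -> R -> R[i]) :
  (forall k, (k < n)%N -> trig_poly_deg_le d (f k)) ->
  trig_poly_deg_le d (fun t => \sum_(k < n) f k t).
Proof.
elim: n => [_|n IHn fd].
  by under eq_fun do rewrite big_ord0; exact: trig_poly_deg_le_cst.
under eq_fun do rewrite big_ord_recr /=.
by apply: trig_poly_deg_leD; [apply: IHn => k kn; exact/fd/ltnW|exact: fd].
Qed.

Lemma trig_poly_deg_le_conjc d f :
  trig_poly_deg_le d f -> trig_poly_deg_le d (fun t => ((f t)^*)%C).
Proof.
move=> [c fE]; exists (fun n => ((c (- n))^*)%C) => t.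
rewrite fE raddf_sum (reindex_inj rev_ord_inj) /=; apply: eq_bigr => j _.
rewrite [LHS]rmorphM [X in _ * X]conjc_expi -mulNr -rmorphN /= opprB.
by congr (conjc (c _) * expi (_%:~R * _)); have := ltn_ord j; lia.
Qed.

Lemma trig_poly_deg_le_sqmod d f : trig_poly_deg_le d f ->
  trig_poly_deg_le (2 * d) (fun t => ((sqmod (f t))%:C)%C).
Proof.
move=> fd; under eq_fun do rewrite sqmod_mulc.
by rewrite mul2n -addnn; exact: trig_poly_deg_leM (trig_poly_deg_le_conjc fd).
Qed.

Lemma continuous_Re_trig_poly d f :
  trig_poly_deg_le d f -> continuous (fun t => complex.Re (f t)).
Proof.
move=> [c fE] t; under eq_fun do rewrite fE raddf_sum.
apply: cvg_big => [|j _]; first exact: add_continuous.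
set l := (_%:~R : R); case: (c _) => a b.
under eq_fun do rewrite /expi /=.
have cl : l * x @[x --> t] --> l * t by apply: cvgMr; exact: cvg_id.
apply: cvgB; apply: cvgMr.
- exact: cvg_comp cl (@continuous_cos R _).
- exact: cvg_comp cl (@continuous_sin R _).
Qed.

(* The Banach indicatrix of a nonconstant [A] is at most [K] over a period. *)
Definition indicatrix_le (T : Type) (K : nat) (A : R -> T) :=
  forall v t (s : seq R), uniq s ->
    (forall x, x \in s -> t <= x < t + 2 * pi /\ A x = v) ->
    (K < size s)%N -> forall x, A x = v.

Lemma indicatrix_le_trig_poly d f :
  trig_poly_deg_le d f -> indicatrix_le (2 * d) f.
Proof.
move=> /trig_poly_deg_leP[p sp fp] v t s us sv sK.
pose q := p - v%:P * 'X^d.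
have qE u : q.[expi u] = (f u - v) * expi u ^+ d.
  by rewrite hornerD hornerN hornerM hornerC hornerXn -fp mulrBl.
have sq : (size q <= (2 * d).+1)%N.
  apply: leq_trans (size_polyD _ _) _; rewrite geq_max sp size_polyN.
  by apply: leq_trans (size_polyMleq _ _) _; rewrite size_polyC size_polyXn; lia.
have q0 : q = 0.
  apply/eqP/negPn/negP => q0.
  suff : (size (map (@expi R) s) < size q)%N by rewrite size_map; lia.
  apply: max_poly_roots => //.
    apply/allP => _ /mapP[u us' ->]; rewrite rootE qE.
    by have [_ ->] := sv u us'; rewrite subrr mul0r.
  rewrite map_inj_in_uniq// => u w us' ws.
  exact: expi_inj (sv u us').1 (sv w ws).1.
move=> x; have /eqP := qE x; rewrite q0 horner0 eq_sym mulf_eq0 expf_eq0.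
by rewrite (negbTE (expi_neq0 x)) andbF orbF subr_eq0 => /eqP.
Qed.

Lemma indicatrix_le_comp (T T' : Type) K (A : R -> T) (psi : T -> T') :
  (forall x y, psi (A x) = psi (A y) -> A x = A y) ->
  indicatrix_le K A -> indicatrix_le K (psi \o A).
Proof.
move=> psi_inj AK v t [//|z s] us sv sK x.
have [_ psiz] := sv z (mem_head _ _); rewrite -psiz /=; congr psi.
apply: (AK _ t _ us _ sK) => w ws; have [tw psiw] := sv w ws.
by split=> //; apply: psi_inj; rewrite -/((psi \o A) w) psiw.
Qed.

Lemma indicatrix_le_cst (T : Type) K (v : T) : indicatrix_le K (fun=> v).
Proof. by move=> w t [//|z s] _ /(_ z (mem_head _ _))[_ ->]. Qed.

Lemma indicatrix_le_sum_sqmod (f : nat -> R -> R[i]) (d : nat -> nat) D n :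
  (forall k, (k < n)%N -> trig_poly_deg_le (d k) (f k)) ->
  (forall k, (k < n)%N -> (d k <= D)%N) ->
  indicatrix_le (4 * D) (fun x => \sum_(k < n) sqmod (f k x)).
Proof.
move=> f_deg dD.
have sum_deg : trig_poly_deg_le (2 * D)
    (fun x => \sum_(k < n) ((sqmod (f k x))%:C)%C).
  apply: (trig_poly_deg_le_sum (f := fun k x => ((sqmod (f k x))%:C)%C)) => k kn.
  apply: (trig_poly_deg_leW _ (trig_poly_deg_le_sqmod (f_deg k kn))).
  by rewrite leq_mul2l dD.
have -> : (fun x => \sum_(k < n) sqmod (f k x))
    = @complex.Re R \o (fun x => \sum_(k < n) ((sqmod (f k x))%:C)%C).
  by apply/funext => x /=; rewrite -rmorph_sum.
rewrite (_ : 4 * D = 2 * (2 * D))%N; last by lia.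
apply: indicatrix_le_comp (indicatrix_le_trig_poly sum_deg) => x y.
by rewrite -!rmorph_sum /= => ->.
Qed.

End TrigonometricPolynomials.

Section PeriodicFunctions.
Variable R : realType.
Implicit Types (a x T : R).

Lemma periodicz (V : zmodType) (f : R -> V) T :
  periodic f T -> forall (n : int) x, f (x + T *~ n) = f x.
Proof.
move=> fT [] n x; rewrite ?NegzE ?mulrNz -pmulrn; first exact: periodicn.
by rewrite -[LHS](periodicn fT n.+1) subrK.
Qed.

Lemma exists_addz_itv T a x : 0 < T -> exists n : int, a <= x + T *~ n < a + T.
Proof.
move=> T0; exists (- Num.floor ((x - a) / T)).
have /andP[] := floor_itv ((x - a) / T).
rewrite ler_pdivlMr// ltr_pdivrMr//; move: (Num.floor _) => n.
rewrite intrD mulr1z mulrDl mul1r mulrNz -mulrzl => ? ?.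
by apply/andP; split; lra.
Qed.

Lemma periodic_bounded (f : R -> R) T : 0 < T -> continuous f -> periodic f T ->
  exists M, forall x, `|f x| <= M.
Proof.
move=> T0 cf fT.
have [|c _ fc] := @EVT_max R (fun x => `|f x|) 0 T (ltW T0).
  apply: continuous_subspaceT => x.
  by apply: continuous_comp; [exact: cf|exact: norm_continuous].
exists `|f c| => x; have [n /andP[n0 nT]] := exists_addz_itv 0 x T0.
rewrite -(periodicz fT n); apply: fc.
by move: nT; rewrite add0r in_itv/= n0 => /ltW.
Qed.

Lemma periodic_le_addr (S : R -> R) (e : R) T : 0 < T -> periodic S T ->
  (forall x y, x <= y < x + T -> S y <= S x + e) -> forall x y, S y <= S x + e.
Proof.
move=> T0 ST Se x y; have [n xyn] := exists_addz_itv x y T0.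
by rewrite -(periodicz ST n y); exact: Se.
Qed.

End PeriodicFunctions.

Lemma sum_itv_length_le (R : realType) (n p : nat) (l u : R) (a b : 'I_n -> R) :
  l <= u -> (forall i, l <= a i) -> (forall i, b i <= u) ->
  (forall v, (#|[set i | (a i < v < b i)%R]%SET| <= p)%N) ->
  \sum_i (b i - a i) <= p%:R * (u - l).
Proof.
move=> lu la bu overlap.
pose I i : set (measurableTypeR R) := `]a i, b i[%classic.
have mI i : measurable (I i) by exact: measurable_itv.
have length_I i : ((b i - a i)%:E
    <= \int[lebesgue_measure]_(x in `[l, u]) (\1_(I i) x)%:E)%E.
  rewrite integral_indic// setIidl; last first.
    move=> x; rewrite /I/= !in_itv/= => /andP[ax xb].
    by rewrite (le_trans (la i) (ltW ax)) (le_trans (ltW xb) (bu i)).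
  rewrite /I/= lebesgue_measure_itv/= lte_fin -EFinD.
  by case: ltP => // ba; rewrite lee_fin subr_le0.
rewrite -lee_fin -sumEFin; apply: (le_trans (lee_sum _ (fun i _ => length_I i))).
have mindic i : measurable_fun (`[l, u] : set (measurableTypeR R))
    (fun x => (\1_(I i) x)%:E).
  exact/measurable_EFinP/measurable_indic.
rewrite -ge0_integral_sum//.
apply: (@le_trans _ _ (\int[lebesgue_measure]_(x in `[l, u]) (p%:R)%:E)%E).
  apply: ge0_le_integral => //.
  - by move=> x _; apply: sume_ge0.
  - exact: emeasurable_sum.
  - move=> x _; rewrite sumEFin lee_fin.
    under eq_bigr do rewrite indicE.
    rewrite -natr_sum ler_nat; apply: leq_trans (overlap x).
    rewrite -sum1_card big_mkcond/= [leqRHS]big_mkcond/=; apply: leq_sum => i _.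
    by rewrite !inE /I/= mem_setE in_itv/=; case: ifP.
rewrite integral_cst//= lebesgue_measure_itv/= lte_fin.
by case: ltP => lu'; rewrite ?mule0 -?EFinD -?EFinM lee_fin ?mulr_ge0 ?subr_ge0.
Qed.

Section EquispacedMeans.
Variable R : realType.

Lemma twopi_gt0 : 0 < 2 * pi :> R.
Proof. by rewrite mulr_gt0// pi_gt0. Qed.

Definition equispaced_mean (n : nat) (h : R -> R) (x : R) : R :=
  n%:R^-1 * \sum_(m < n) h (x + (2 * pi / n%:R) *+ m).

Lemma mesh_mulrn n : (0 < n)%N -> (2 * pi / n%:R) *+ n = 2 * pi :> R.
Proof. by move=> n0; rewrite -mulr_natr divfK// pnatr_eq0 -lt0n. Qed.

Lemma mesh_gt0 n : (0 < n)%N -> 0 < 2 * pi / n%:R :> R.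
Proof. by move=> n0; rewrite divr_gt0 ?twopi_gt0 ?ltr0n. Qed.

Lemma periodic_mesh n (h : R -> R) :
  (0 < n)%N -> periodic h (2 * pi / n%:R) -> periodic h (2 * pi).
Proof. by move=> n0 hp x; rewrite -[in LHS](mesh_mulrn n0); exact: periodicn. Qed.

Lemma equispaced_mean_periodic n (h : R -> R) : (0 < n)%N ->
  periodic h (2 * pi) -> periodic (equispaced_mean n h) (2 * pi / n%:R).
Proof.
case: n => // n _ h2pi x; congr (_ * _); set delta := _ / _.
rewrite [LHS]big_ord_recr [RHS]big_ord_recl /= addrC mulr0n addr0; congr (_ + _).
  by rewrite -addrA -mulrS mesh_mulrn.
by apply: eq_bigr => m _; rewrite -addrA -mulrS.
Qed.

Variables (h : R -> R) (K N : nat) (l u : R).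
Hypotheses (h_cont : continuous h) (h_level : indicatrix_le K h) (N_gt0 : (0 < N)%N).

Let delta : R := 2 * pi / N%:R.
Let delta_gt0 : 0 < delta := mesh_gt0 N_gt0.

(* By the intermediate value theorem, each translated interval
   [x + m delta, y + m delta] on which [h] crosses [v] contains a point of the
   level set of [v], and these intervals are disjoint within one period. *)
Lemma card_crossings_le (x y v : R) : x <= y < x + delta ->
  (#|[set m : 'I_N | (h (x + delta *+ m) < v < h (y + delta *+ m))%R]%SET| <= K)%N.
Proof.
move=> /andP[xy yx]; set crossings := finset _.
have /choice[z zP] : forall m : 'I_N, exists z, m \in crossings ->
    x + delta *+ m <= z <= y + delta *+ m /\ h z = v.
  move=> m; rewrite inE; have [/andP[hv vh]|_] := boolP (_ < _ < _); last by exists 0.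
  have [|||z zxy hz] := @IVT R h (x + delta *+ m) (y + delta *+ m) v.
  - by rewrite lerD2r.
  - exact: continuous_subspaceT.
  - by rewrite ge_min le_max (ltW hv) (ltW vh) orbT.
  by exists z.
have z_cell m : m \in crossings -> x + delta *+ m <= z m < x + delta *+ m.+1.
  move=> /zP[/andP[xz zy] _]; rewrite xz (le_lt_trans zy)//.
  by rewrite mulrS addrA ltrD2r.
rewrite leqNgt; apply/negP => K_lt.
suff hv : forall w, h w = v.
  have [m] : exists m, m \in crossings by apply/set0Pn; rewrite -card_gt0; lia.
  by rewrite inE hv ltxx.
apply: (h_level (t := x) (s := [seq z m | m <- enum crossings])).
- rewrite map_inj_in_uniq ?enum_uniq// => m m'; rewrite !mem_enum => mc mc' zz.
  suff index_z i : i \in crossings -> Num.truncn ((z i - x) / delta) = i.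
    by apply: val_inj; rewrite /= -(index_z m)// zz index_z.
  move=> /z_cell /andP[xz zx]; apply: truncn_def.
  by rewrite ler_pdivlMr// ltr_pdivrMr// !mulr_natl lerBrDl ltrBlDl xz.
- move=> z0 /mapP[m]; rewrite mem_enum => mc ->; have [_ hz] := zP m mc.
  split=> //; have /andP[xz zx] := z_cell m mc.
  rewrite (le_trans _ xz) ?lerDl ?mulrn_wge0 ?(ltW delta_gt0)//=.
  rewrite (lt_le_trans zx)// -(mesh_mulrn N_gt0) lerD2l.
  by rewrite ler_wpMn2l// ltW.
- by rewrite size_map -cardE.
Qed.

Hypotheses (hD2pi : periodic h (2 * pi)) (h_ge : forall x, l <= h x).
Hypothesis h_le : forall x, h x <= u.

Lemma equispaced_mean_osc s t :
  equispaced_mean N h s <= equispaced_mean N h t + K%:R / N%:R * (u - l).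
Proof.
apply: (periodic_le_addr delta_gt0) => [|x y xy]; first exact: equispaced_mean_periodic.
rewrite [_ / _]mulrC -mulrA -mulrDr ler_pM2l ?invr_gt0 ?ltr0n//.
rewrite -lerBlDl -sumrB; apply: sum_itv_length_le => // [|v].
- exact: le_trans (h_ge 0) (h_le 0).
- exact: card_crossings_le.
Qed.

End EquispacedMeans.

Section SqrtIncrements.
Variable R : rcfType.
Implicit Types a b : R.

Definition sqrt_increment b a : R := Num.sqrt (a + b) - Num.sqrt a.

Lemma sqrt_increment0 a : sqrt_increment 0 a = 0.
Proof. by rewrite /sqrt_increment addr0 subrr. Qed.

Lemma sqrt_increment_ge0 b a : 0 <= b -> 0 <= sqrt_increment b a.
Proof. by move=> b0; rewrite subr_ge0 ler_wsqrtr// lerDl. Qed.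

Lemma sqrt_increment_lt b a a' : 0 < b -> 0 <= a -> a < a' ->
  sqrt_increment b a' < sqrt_increment b a.
Proof.
move=> b0 a0 aa'; have a'0 := le_lt_trans a0 aa'.
have increment_mul_sum c : 0 <= c ->
    sqrt_increment b c * (Num.sqrt (c + b) + Num.sqrt c) = b.
  by move=> c0; rewrite -subr_sqr !sqr_sqrtr ?addr_ge0 ?(ltW b0)//; ring.
have sum_lt : Num.sqrt (a + b) + Num.sqrt a < Num.sqrt (a' + b) + Num.sqrt a'.
  by rewrite ltrD ?ltr_sqrt ?ltrD2r ?addr_gt0.
have sum_gt0 : 0 < Num.sqrt (a + b) + Num.sqrt a.
  by rewrite ltr_pwDl ?sqrtr_gt0 ?sqrtr_ge0 ?ltr_wpDl.
rewrite -(ltr_pM2r sum_gt0) increment_mul_sum// -[ltRHS](increment_mul_sum a' (ltW a'0)).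
rewrite ltr_pM2l// -(pmulr_lgt0 _ (lt_trans sum_gt0 sum_lt)) increment_mul_sum//.
exact: ltW.
Qed.

Lemma sqrt_increment_inj b : 0 < b ->
  {in Num.nneg &, injective (sqrt_increment b)}.
Proof.
move=> b0 a a'; rewrite !nnegrE => a0 a'0 incr_eq.
have [aa'|aa'|//] := ltgtP a a'.
- by have := sqrt_increment_lt b0 a0 aa'; rewrite incr_eq ltxx.
- by have := sqrt_increment_lt b0 a'0 aa'; rewrite incr_eq ltxx.
Qed.

Lemma sqrt_increment_le b a a' : 0 <= b -> 0 <= a -> a <= a' ->
  sqrt_increment b a' <= sqrt_increment b a.
Proof.
move=> b_ge0 a0; rewrite le_eqVlt => /predU1P[->//|aa'].
move: b_ge0; rewrite le_eqVlt => /predU1P[<-|b0]; first by rewrite !sqrt_increment0.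
exact/ltW/sqrt_increment_lt.
Qed.

End SqrtIncrements.

Definition bounded_mfun d (T : measurableType d) (R : realType) (f : T -> R) :=
  measurable_fun setT f /\ exists M : R, forall x, `|f x| <= M.

Section BoundedMeasurableFunctions.
Context d (T : measurableType d) (R : realType).
Implicit Types f g : T -> R.

Lemma bounded_mfun_cst (c : R) : bounded_mfun (fun _ : T => c).
Proof. by split=> //; exists `|c|. Qed.

Lemma bounded_mfunD f g :
  bounded_mfun f -> bounded_mfun g -> bounded_mfun (fun x => f x + g x).
Proof.
move=> [mf [M fM]] [mg [N gN]]; split; first exact: measurable_funD.
by exists (M + N) => x; rewrite (le_trans (ler_normD _ _))// lerD.
Qed.

Lemma bounded_mfunB f g :
  bounded_mfun f -> bounded_mfun g -> bounded_mfun (fun x => f x - g x).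
Proof.
move=> [mf [M fM]] [mg [N gN]]; split; first exact: measurable_funB.
by exists (M + N) => x; rewrite (le_trans (ler_normB _ _))// lerD.
Qed.

Lemma bounded_mfunZ (c : R) f :
  bounded_mfun f -> bounded_mfun (fun x => c * f x).
Proof.
move=> [mf [M fM]]; split; first exact: measurable_funM.
by exists (`|c| * M) => x; rewrite normrM ler_wpM2l.
Qed.

Lemma bounded_mfun_norm f : bounded_mfun f -> bounded_mfun (fun x => `|f x|).
Proof.
move=> [mf [M fM]]; split; first exact: measurableT_comp.
by exists M => x; rewrite normr_id.
Qed.

Lemma bounded_mfun_sqrt f :
  bounded_mfun f -> bounded_mfun (fun x => Num.sqrt (f x)).
Proof.
move=> [mf [M fM]]; split.
  exact: measurableT_comp (continuous_measurable_fun (@sqrt_continuous R)) mf.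
exists (Num.sqrt M) => x; rewrite ger0_norm ?sqrtr_ge0// ler_wsqrtr//.
exact: le_trans (ler_norm _) (fM x).
Qed.

Lemma bounded_mfun_sum (I : Type) (r : seq I) (h : I -> T -> R) :
  (forall i, bounded_mfun (h i)) -> bounded_mfun (fun x => \sum_(i <- r) h i x).
Proof.
move=> hb; elim: r => [|i r IHr].
  by under eq_fun do rewrite big_nil; exact: bounded_mfun_cst.
by under eq_fun do rewrite big_cons; exact: bounded_mfunD.
Qed.

Lemma bounded_mfun_comp d' (T' : measurableType d') (g : T' -> T) f :
  measurable_fun setT g -> bounded_mfun f -> bounded_mfun (fun x => f (g x)).
Proof.
by move=> mg [mf [M fM]]; split; [exact: measurableT_comp|exists M].
Qed.

Lemma bounded_mfun_integrable (mu : {measure set T -> \bar R}) f :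
  (mu setT < +oo)%E -> bounded_mfun f -> mu.-integrable setT (EFin \o f).
Proof.
move=> mu_fin [mf [M fM]]; apply: measurable_bounded_integrable => //.
by exists M; split=> [|N MN x _ /=]; rewrite ?num_real// (le_trans (fM x))// ltW.
Qed.

Variable P : probability T R.

Lemma bounded_mfun_prob_integrable f :
  bounded_mfun f -> P.-integrable setT (EFin \o f).
Proof. by apply: bounded_mfun_integrable; rewrite [ltLHS]probability_setT ltry. Qed.

Lemma EFin_Rintegral f :
  bounded_mfun f -> (\int[P]_x f x)%:E = (\int[P]_x (f x)%:E)%E.
Proof.
by move=> fb; rewrite fineK//; exact/integrable_fin_num/bounded_mfun_prob_integrable.
Qed.

Lemma Rintegral_prob_cst (c : R) : \int[P]_x c = c.
Proof. by rewrite Rintegral_cst//= probability_setT mulr1. Qed.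

Lemma Rintegral_bounded_mfun_sum (I : Type) (r : seq I) (h : I -> T -> R) :
  (forall i, bounded_mfun (h i)) ->
  \int[P]_x \sum_(i <- r) h i x = \sum_(i <- r) \int[P]_x h i x.
Proof.
move=> hb; elim: r => [|i r IHr].
  by under eq_Rintegral do rewrite big_nil; rewrite Rintegral_prob_cst big_nil.
under eq_Rintegral do rewrite big_cons.
rewrite RintegralD ?IHr ?big_cons//; apply: bounded_mfun_prob_integrable => //.
exact: bounded_mfun_sum.
Qed.

Lemma Rintegral_bounded_mfunB f g : bounded_mfun f -> bounded_mfun g ->
  \int[P]_x (f x - g x) = \int[P]_x f x - \int[P]_x g x.
Proof. by move=> fb gb; rewrite RintegralB//; exact: bounded_mfun_prob_integrable. Qed.

Lemma norm_Rintegral_le f h : bounded_mfun f -> bounded_mfun h ->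
  (forall x, `|f x| <= h x) -> `|\int[P]_x f x| <= \int[P]_x h x.
Proof.
move=> f_bmf h_bmf fh.
apply: (le_trans (le_normr_Rintegral _ (bounded_mfun_prob_integrable f_bmf))) => //.
apply: le_Rintegral => //; apply: bounded_mfun_prob_integrable => //.
exact: bounded_mfun_norm.
Qed.

Lemma dist_Rintegral_le f g h : bounded_mfun f -> bounded_mfun g ->
  bounded_mfun h -> (forall x, `|f x - g x| <= h x) ->
  `|\int[P]_x f x - \int[P]_x g x| <= \int[P]_x h x.
Proof.
move=> f_bmf g_bmf h_bmf fgh; rewrite -Rintegral_bounded_mfunB//.
exact/norm_Rintegral_le/fgh/h_bmf/bounded_mfunB.
Qed.

End BoundedMeasurableFunctions.

Section BoundedFubini.
Context d1 d2 (T1 : measurableType d1) (T2 : measurableType d2) (R : realType).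
Variables (P2 : probability T2 R) (f : T1 * T2 -> R).
Hypothesis f_bmf : bounded_mfun f.

Lemma bounded_mfun_section x : bounded_mfun (fun y => f (x, y)).
Proof. exact: bounded_mfun_comp (measurable_pair1 x) f_bmf. Qed.

Lemma bounded_mfun_prod_integrable (P1 : probability T1 R) :
  (P1 \x P2)%E.-integrable setT (EFin \o f).
Proof.
apply: bounded_mfun_integrable f_bmf; rewrite -setXTT [ltLHS]product_measure1E//.
by rewrite [X in (X * _)%E]probability_setT mul1e [ltLHS]probability_setT ltry.
Qed.

Let EFin_section x :
  (\int[P2]_y f (x, y))%:E = fubini_F P2 (EFin \o f) x.
Proof. exact/EFin_Rintegral/bounded_mfun_section. Qed.

Lemma bounded_mfun_Rintegral : bounded_mfun (fun x => \int[P2]_y f (x, y)).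
Proof.
split; last first.
  have [_ [M fM]] := f_bmf; exists M => x.
  rewrite -[leRHS](Rintegral_prob_cst P2); apply: norm_Rintegral_le => //.
    exact: bounded_mfun_section.
  exact: bounded_mfun_cst.
(* The library states measurability for a product measure; any probability on
   [T1] will do. *)
apply/measurable_EFinP; rewrite (_ : _ \o _ = fubini_F P2 (EFin \o f)).
  exact: measurable_fubini_F (bounded_mfun_prod_integrable (\d_point)).
exact/funext/EFin_section.
Qed.

Lemma Rintegral12_prod (P1 : probability T1 R) :
  \int[P1]_x \int[P2]_y f (x, y) = \int[(P1 \x P2)%E]_z f z.
Proof.
congr fine; rewrite -[RHS](integral12_prod_meas1 (bounded_mfun_prod_integrable P1)).
by apply: eq_integral => x _; exact: EFin_section.
Qed.

End BoundedFubini.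

Section TorusMeasure.
Variable R : realType.
Local Notation torus := (measurableTypeR R).
Local Notation leb := (@lebesgue_measure R).

Definition torus_prob : probability torus R := uniform_prob (twopi_gt0 R).

Lemma torus_probE (A : set torus) : measurable A -> torus_prob A = muT A.
Proof.
move=> mA; rewrite /torus_prob/= /uniform_prob integral_uniform_pdf /muT /I2pi.
rewrite (eq_integral (fun=> ((2 * pi)^-1)%:E)); last first.
  move=> x /set_mem[_]/=; rewrite in_itv/= => xI.
  by rewrite /uniform_pdf xI subr0.
by rewrite integral_cst//; exact: measurableI.
Qed.

Lemma integral_torus (f : torus -> \bar R) :
  measurable_fun setT f -> (forall x, 0 <= f x)%E ->
  (\int[torus_prob]_x f x
    = ((2 * pi)^-1)%:E * \int[leb]_(x in @I2pi R) f x)%E.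
Proof. by move=> mf f0; rewrite /torus_prob/= integral_uniform// subr0. Qed.

Lemma measurable_shift (c : R) : measurable_fun setT (shift c : torus -> torus).
Proof. by apply: measurable_funD => //; exact: measurable_cst. Qed.

Lemma lebesgue_measure_shift (c : R) (A : set torus) : measurable A ->
  pushforward leb (shift c : torus -> torus) A = leb A.
Proof.
move=> mA; pose f : {mfun torus >-> torus} :=
  HB.pack (shift c : torus -> torus)
    (isMeasurableFun.Build _ _ _ _ _ (measurable_shift c)).
apply/esym; apply: (@lebesgue_measure_unique R (pushforward leb f)) => //.
move=> _ [[a b]] _ <-; rewrite /pushforward.
transitivity (leb (`]a - c, b - c]%classic : set torus)).
  rewrite !lebesgue_measure_itv/= !lte_fin ltrD2r.
  by case: ifP => // _; rewrite -!EFinB; congr EFin; ring.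
congr lebesgue_measure.
by apply/seteqP; split => x /=; rewrite !in_itv/= ltrBlDr lerBrDr.
Qed.

Lemma integral_itv_shift (f : torus -> \bar R) (a b c : R) :
  measurable_fun setT f -> (forall x, 0 <= f x)%E ->
  (\int[leb]_(x in `[a, b[) f (x + c)%R
    = \int[leb]_(x in `[(a + c)%R, (b + c)%R[) f x)%E.
Proof.
move=> mf f0.
have -> : `[a, b[%classic = (shift c : torus -> torus) @^-1` `[a + c, b + c[%classic.
  by apply/seteqP; split => x /=; rewrite !in_itv/= lerD2r ltrD2r.
rewrite -(@ge0_integral_pushforward _ _ _ _ _ _ (measurable_shift c) _ _ f)//.
  apply: eq_measure_integral => [|mg A mA _]; first exact: measurable_shift.
  exact: lebesgue_measure_shift.
exact: measurable_funTS.
Qed.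

Lemma ge0_integral_itv_periodic (f : torus -> \bar R) (T c : R) :
  measurable_fun setT f -> (forall x, 0 <= f x)%E ->
  (forall x, f (x + T)%R = f x) -> 0 <= c <= T ->
  (\int[leb]_(x in `[c, (c + T)%R[) f x = \int[leb]_(x in `[0%R, T[) f x)%E.
Proof.
move=> mf f0 fT /andP[c0 cT].
have split_itv (a b e : R) : a <= b -> b <= e ->
    (\int[leb]_(x in `[a, e[) f x
     = \int[leb]_(x in `[a, b[) f x + \int[leb]_(x in `[b, e[) f x)%E.
  move=> ab be; rewrite -ge0_integral_setU//.
  - by rewrite -itv_bndbnd_setU// !bnd_simp.
  - exact: measurable_funTS.
  - apply/disj_setPS => x [] /=; rewrite !in_itv/= => /andP[_ xb] /andP[bx _].
    by move: xb; rewrite ltNge bx.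
rewrite (split_itv c T)// ?lerDr// [RHS](split_itv 0 c)// addeC; congr (_ + _)%E.
rewrite -[X in `[X, _[](add0r T) -integral_itv_shift//.
by under eq_integral do rewrite fT.
Qed.

Lemma ge0_integral_torus_shift (f : torus -> \bar R) (c : R) :
  measurable_fun setT f -> (forall x, 0 <= f x)%E ->
  (forall x, f (x + 2 * pi)%R = f x) -> 0 <= c <= 2 * pi ->
  (\int[torus_prob]_x f (x + c)%R = \int[torus_prob]_x f x)%E.
Proof.
move=> mf f0 f2pi c_itv.
have mfc : measurable_fun setT (fun x : torus => f (x + c)).
  exact: measurableT_comp mf (measurable_shift c).
rewrite !integral_torus//; congr (_ * _)%E; rewrite /I2pi.
rewrite -!integral_itv_bndo_bndc; try exact: measurable_funTS.
by rewrite integral_itv_shift// add0r addrC ge0_integral_itv_periodic.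
Qed.

Lemma Rintegral_torus_shift (f : torus -> R) (c : R) :
  bounded_mfun f -> periodic (f : R -> R) (2 * pi) ->
  \int[torus_prob]_x f (x + c) = \int[torus_prob]_x f x.
Proof.
move=> fb f2pi; have [mf [M fM]] := fb.
have [n /andP[n0 n2pi]] := exists_addz_itv 0 c (twopi_gt0 R).
have fc x : f (x + c) = f (x + (c + (2 * pi) *~ n)).
  by rewrite addrA (periodicz f2pi).
under eq_Rintegral do rewrite fc.
have addM (g : torus -> R) : bounded_mfun g ->
    \int[torus_prob]_x g x = \int[torus_prob]_x (g x + M) - M.
  move=> gb; rewrite RintegralD ?Rintegral_prob_cst ?addrK//.
  - exact: bounded_mfun_prob_integrable.
  - exact: bounded_mfun_prob_integrable (bounded_mfun_cst _ M).
rewrite addM; last exact: bounded_mfun_comp (measurable_shift _) fb.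
rewrite [RHS]addM//; congr (fine _ - _).
apply: (@ge0_integral_torus_shift (fun x => (f x + M)%:E)).
- by apply/measurable_EFinP; exact: measurable_funD.
- move=> x; rewrite lee_fin -lerBlDr sub0r.
  by have := fM x; rewrite ler_norml => /andP[].
- by move=> x; rewrite f2pi.
- by rewrite n0 -[leRHS]add0r ltW.
Qed.

Lemma continuous_periodic_bounded_mfun (f : R -> R) :
  continuous f -> periodic f (2 * pi) -> bounded_mfun (f : torus -> R).
Proof.
move=> cf f2pi; split; first exact: continuous_measurable_fun.
exact: periodic_bounded (twopi_gt0 R) cf f2pi.
Qed.

Lemma bounded_mfun_equispaced_mean n (f : torus -> R) :
  bounded_mfun f -> bounded_mfun (equispaced_mean n f : torus -> R).
Proof.
move=> fb; apply: bounded_mfunZ; apply: bounded_mfun_sum => m.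
exact: bounded_mfun_comp (measurable_shift _) fb.
Qed.

Lemma Rintegral_equispaced_mean n (f : torus -> R) : (0 < n)%N ->
  bounded_mfun f -> periodic (f : R -> R) (2 * pi) ->
  \int[torus_prob]_x equispaced_mean n f x = \int[torus_prob]_x f x.
Proof.
move=> n0 fb f2pi; have fb_shift (c : R) : bounded_mfun (fun x : torus => f (x + c)).
  exact: bounded_mfun_comp (measurable_shift c) fb.
rewrite RintegralZl//; last first.
  by apply: bounded_mfun_prob_integrable; apply: bounded_mfun_sum.
rewrite Rintegral_bounded_mfun_sum//; under eq_bigr do rewrite Rintegral_torus_shift//.
rewrite sumr_const card_ord -[X in _ * X]mulr_natl mulKf//.
by rewrite pnatr_eq0 -lt0n.
Qed.

Lemma equispaced_mean_discrepancy (h : R -> R) (K n : nat) (l u : R) x :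
  (0 < n)%N -> continuous h -> periodic h (2 * pi) -> indicatrix_le K h ->
  (forall t, l <= h t) -> (forall t, h t <= u) ->
  `|equispaced_mean n h x - \int[torus_prob]_t h t| <= K%:R / n%:R * (u - l).
Proof.
move=> n0 ch h2pi hK lh hu.
have hb := continuous_periodic_bounded_mfun ch h2pi.
have mean_b := bounded_mfun_equispaced_mean n hb.
have cst_b c : bounded_mfun (fun _ : torus => c) by exact: bounded_mfun_cst.
rewrite -(Rintegral_equispaced_mean n0 hb h2pi).
rewrite -{1}(Rintegral_prob_cst torus_prob (equispaced_mean n h x)).
rewrite -[leRHS](Rintegral_prob_cst torus_prob).
apply: dist_Rintegral_le => // t.
by rewrite ler_distl lerBlDr !(equispaced_mean_osc ch hK n0 h2pi lh hu).
Qed.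

(* Along the diagonal, 2pi/n-periodicity in the second variable turns the
   integral of [F x x] into that of the equispaced mean of [F ^~ x] at [x]. *)
Lemma diagonal_discrepancy (F : R -> R -> R) (M : R -> R) (K n : nat) :
  (0 < n)%N -> bounded_mfun (fun sx : torus * torus => F sx.2 sx.1) ->
  bounded_mfun (M : torus -> R) ->
  (forall s, continuous (F ^~ s)) -> (forall s, periodic (F ^~ s) (2 * pi)) ->
  (forall s, indicatrix_le K (F ^~ s)) ->
  (forall x, periodic (F x) (2 * pi / n%:R)) ->
  (forall x s, 0 <= F x s <= M s) ->
  `|\int[torus_prob]_x F x x - \int[torus_prob]_s \int[torus_prob]_x F x s|
    <= K%:R / n%:R * \int[torus_prob]_s M s.
Proof.
move=> n0 Fb Mb cF F2pi FK Fper FM.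
pose diag : R -> R := fun x => F x x.
have diag_b : bounded_mfun (diag : torus -> R).
  apply: (bounded_mfun_comp (g := fun x : torus => (x, x))) Fb.
  exact: measurable_fun_pair.
have diag2pi : periodic diag (2 * pi).
  by move=> x; rewrite /diag F2pi (periodic_mesh n0 (Fper x)).
have mean_diag s : equispaced_mean n diag s = equispaced_mean n (F ^~ s) s.
  by congr (_ * _); apply: eq_bigr => m _; rewrite /diag (periodicn (Fper _)).
rewrite -(Rintegral_equispaced_mean n0 diag_b diag2pi).
rewrite -RintegralZl//; last exact: bounded_mfun_prob_integrable.
apply: dist_Rintegral_le => [|||s].
- exact: bounded_mfun_equispaced_mean.
- exact: (bounded_mfun_Rintegral torus_prob Fb).
- exact: bounded_mfunZ.
rewrite mean_diag -[M s]subr0; apply: equispaced_mean_discrepancy => // x.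
- by have /andP[] := FM x s.
- by have /andP[] := FM x s.
Qed.

End TorusMeasure.

Section SqrtDecoupling.
Variable R : realType.
Local Notation torus := (measurableTypeR R).
Local Notation U := (torus_prob R).
Variables (A X : R -> R) (K n : nat) (kappa y : R).
Hypotheses (A_cont : continuous A) (A2pi : periodic A (2 * pi)).
Hypotheses (A_ge0 : forall x, 0 <= A x) (A_level : indicatrix_le K A).
Hypotheses (n_gt0 : (0 < n)%N) (X_cont : continuous X).
Hypotheses (X_per : periodic X (2 * pi / n%:R)) (X_ge0 : forall x, 0 <= X x).
Hypotheses (K_le : K%:R <= kappa * n%:R) (y_ge0 : 0 <= y).

Let A_bmf : bounded_mfun (A : torus -> R).
Proof. exact: continuous_periodic_bounded_mfun. Qed.

Let X_bmf : bounded_mfun (X : torus -> R).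
Proof. exact: continuous_periodic_bounded_mfun (periodic_mesh n_gt0 X_per). Qed.

Let Ay_bmf : bounded_mfun (fun x : torus => A x + y).
Proof. exact/bounded_mfunD/bounded_mfun_cst. Qed.

Let sqrt_yX_bmf : bounded_mfun (fun s : torus => Num.sqrt (y + X s)).
Proof. exact/bounded_mfun_sqrt/bounded_mfunD/X_bmf/bounded_mfun_cst. Qed.

Let sqrt_AyX_bmf :
  bounded_mfun (fun sx : torus * torus => Num.sqrt (A sx.2 + y + X sx.1)).
Proof.
apply/bounded_mfun_sqrt/bounded_mfunD.
  exact: bounded_mfun_comp measurable_snd Ay_bmf.
exact: bounded_mfun_comp measurable_fst X_bmf.
Qed.

Let Ay_ge0 x : 0 <= A x + y. Proof. exact: addr_ge0. Qed.

Lemma indicatrix_le_sqrt_increment b : 0 <= b ->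
  indicatrix_le K (fun x => sqrt_increment b (A x + y)).
Proof.
rewrite le_eqVlt => /predU1P[<-|b0].
  by under eq_fun do rewrite sqrt_increment0; exact: indicatrix_le_cst.
apply: (indicatrix_le_comp (psi := fun a => sqrt_increment b (a + y))) A_level.
move=> x x' /(sqrt_increment_inj b0).
by rewrite !nnegrE => /(_ (Ay_ge0 _) (Ay_ge0 _)) /addIr.
Qed.

Lemma continuous_sqrt_increment b :
  continuous (fun x => sqrt_increment b (A x + y)).
Proof.
have cAy (c : R) x : A t + c @[t --> x] --> A x + c.
  by apply: cvgD; [exact: A_cont|exact: cvg_cst].
move=> x; apply: (@cvgB R R R).
  by under eq_fun do rewrite -addrA; rewrite -addrA;
    exact: cvg_comp (cAy _ x) (@sqrt_continuous R _).
exact: cvg_comp (cAy _ x) (@sqrt_continuous R _).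
Qed.

Lemma sqrt_decoupling :
  `|\int[U]_x Num.sqrt (A x + y + X x)
      - \int[U]_s \int[U]_x Num.sqrt (A x + y + X s)|
  <= kappa * (\int[U]_s Num.sqrt (y + X s) - Num.sqrt y).
Proof.
pose F x s := sqrt_increment (X s) (A x + y).
have diagE : \int[U]_x F x x
    = \int[U]_x Num.sqrt (A x + y + X x) - \int[U]_x Num.sqrt (A x + y).
  apply: Rintegral_bounded_mfunB (bounded_mfun_sqrt Ay_bmf).
  exact/bounded_mfun_sqrt/bounded_mfunD.
have innerE s : \int[U]_x F x s
    = \int[U]_x Num.sqrt (A x + y + X s) - \int[U]_x Num.sqrt (A x + y).
  apply: Rintegral_bounded_mfunB (bounded_mfun_sqrt Ay_bmf).
  exact: bounded_mfun_section sqrt_AyX_bmf s.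
have outerE : \int[U]_s \int[U]_x F x s
    = \int[U]_s \int[U]_x Num.sqrt (A x + y + X s)
      - \int[U]_x Num.sqrt (A x + y).
  under eq_Rintegral do rewrite innerE.
  rewrite Rintegral_bounded_mfunB ?Rintegral_prob_cst//.
    exact: bounded_mfun_Rintegral sqrt_AyX_bmf.
  exact: bounded_mfun_cst.
have boundE : \int[U]_s sqrt_increment (X s) y
    = \int[U]_s Num.sqrt (y + X s) - Num.sqrt y.
  rewrite -[in RHS](Rintegral_prob_cst U (Num.sqrt y)) -Rintegral_bounded_mfunB//.
  exact: bounded_mfun_cst.
rewrite -boundE [X in `|X|](_ : _
    = \int[U]_x F x x - \int[U]_s \int[U]_x F x s); last first.
  by rewrite diagE outerE opprB addrA subrK.
have kappa_le : K%:R / n%:R <= kappa by rewrite ler_pdivrMr// ltr0n.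
apply: (@le_trans _ _ (K%:R / n%:R * \int[U]_s sqrt_increment (X s) y)); last first.
  by rewrite ler_wpM2r// Rintegral_ge0// => s _; exact: sqrt_increment_ge0.
apply: diagonal_discrepancy => // [||s|s x|s|x s|x s].
- apply: bounded_mfunB sqrt_AyX_bmf _.
  exact/bounded_mfun_sqrt/(bounded_mfun_comp measurable_snd Ay_bmf).
- exact/bounded_mfunB/bounded_mfun_cst.
- exact: continuous_sqrt_increment.
- by rewrite /F A2pi.
- exact: indicatrix_le_sqrt_increment.
- by rewrite /F X_per.
- by rewrite sqrt_increment_ge0// sqrt_increment_le// lerDr.
Qed.

End SqrtDecoupling.
Section InfiniteProduct.
Variable R : realType.
Local Notation torus := (measurableTypeR R).
Local Notation U := (torus_prob R).
Local Notation T := (Tinf R).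

Lemma measurable_coord k : measurable_fun setT ((fun t => t k) : T -> torus).
Proof. by move=> _ A mA; rewrite setTI; apply: sub_sigma_algebra; exists k, A. Qed.

Definition rectangle (n : nat) (A : nat -> set torus) : set T :=
  [set t | forall k, (k < n)%N -> A k (t k)].

Definition rectangles : set (set T) := [set B | exists n A,
  (forall k, measurable (A k)) /\ B = rectangle n A].

Lemma measurable_rectangle n A :
  (forall k, measurable (A k)) -> measurable (rectangle n A).
Proof.
move=> mA; have -> : rectangle n A
    = \bigcap_(k in [set k | (k < n)%N]) ((fun t : T => t k) @^-1` A k).
  by apply/seteqP; split.
apply: bigcap_measurableType => k _.
by rewrite -[X in measurable X]setTI; exact: measurable_coord.
Qed.

Lemma setI_closed_rectangles : setI_closed rectangles.
Proof.
move=> _ _ [n [A [mA ->]]] [n' [A' [mA' ->]]].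
pose B k := (if (k < n)%N then A k else setT) `&` (if (k < n')%N then A' k else setT).
exists (maxn n n'), B; split => [k|].
  by apply: measurableI; case: ifP.
apply/seteqP; split => t /=.
  by move=> [tA tA'] k _; rewrite /B; split; case: ifP => // kn; [exact: tA|exact: tA'].
move=> tB; split => k kn.
  by have := tB k; rewrite leq_max kn => /(_ isT)[]; rewrite kn.
by have := tB k; rewrite leq_max kn orbT => /(_ isT)[_]; rewrite kn.
Qed.

Lemma cylinders_sub_rectangles : @cylinders R `<=` rectangles.
Proof.
move=> _ [k [A [mA ->]]]; exists k.+1, (fun j => if j == k then A else setT).
split=> [j|]; first by case: ifP.
apply/seteqP; split => t /=; first by move=> tA j _; case: eqP => // ->.
by move=> /(_ k (ltnSn k)); rewrite eqxx.
Qed.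

Lemma measure_eq_on_rectangles (m1 m2 : {measure set T -> \bar R}) :
  (m1 setT < +oo)%E -> (forall B, rectangles B -> m1 B = m2 B) ->
  forall B, measurable B -> m1 B = m2 B.
Proof.
move=> m1T m12 B mB.
apply: (g_sigma_algebra_measure_unique rectangles _ (fun=> setT)) => //.
- by move=> _ [n [A [mA ->]]]; exact: measurable_rectangle.
- by move=> _; exists 0%N, (fun=> setT); split=> //; apply/seteqP; split.
- by rewrite bigcup_const.
- exact: setI_closed_rectangles.
- by apply: sub_smallest2r cylinders_sub_rectangles _ mB; exact: smallest_sigma_algebra.
Qed.

Definition resample (i : nat) (ts : T * torus) : T :=
  fun k => if k == i then ts.2 else ts.1 k.

Lemma measurable_resample i : measurable_fun setT (resample i).
Proof.
apply: (@measurability _ _ (T * torus)%type T setT (resample i)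
  (@cylinders R) erefl).
move=> _ [_ [k [A [mA ->]]] <-].
rewrite setTI; have [ki|ki] := eqVneq k i.
  rewrite (_ : _ @^-1` _ = snd @^-1` A); last first.
    by apply/seteqP; split => ts /=; rewrite /resample ki eqxx.
  by rewrite -[X in measurable X]setTI; exact: measurable_snd.
rewrite (_ : _ @^-1` _ = fst @^-1` ((fun t : T => t k) @^-1` A)); last first.
  by apply/seteqP; split => ts /=; rewrite /resample (negbTE ki).
rewrite -[X in measurable X]setTI; apply: measurable_fst => //.
by rewrite -[X in measurable X]setTI; exact: measurable_coord.
Qed.

Lemma preimage_resample_rectangle i n (A : nat -> set torus) :
  resample i @^-1` rectangle n A
  = rectangle n (fun k => if k == i then setT else A k)
    `*` (if (i < n)%N then A i else setT).
Proof.
apply/seteqP; split => [[t s] tA|[t s] [tA sA] k kn] /=.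
  split=> [k kn|]; first by have := tA k kn; rewrite /resample/=; case: ifP.
  by case: ifP => // jn; have := tA i jn; rewrite /resample/= eqxx.
rewrite /resample/=; case: eqP => [ki|/eqP ki].
  by move: sA; rewrite /= -ki kn.
by have := tA k kn; rewrite (negbTE ki).
Qed.

Variable P : probability T R.
Hypothesis P_prod : is_infinite_product P.

Lemma prob_rectangle n (A : nat -> set torus) :
  (forall k, measurable (A k)) -> P (rectangle n A) = (\prod_(k < n) U (A k))%E.
Proof.
move=> mA; rewrite [LHS]P_prod//.
by apply: eq_bigr => k _; rewrite torus_probE.
Qed.

Lemma pushforward_resample i (B : set T) : measurable B ->
  pushforward (P \x U)%E (resample i) B = P B.
Proof.
pose f : {mfun (T * torus)%type >-> T} :=
  HB.pack (resample i) (isMeasurableFun.Build _ _ _ _ _ (measurable_resample i)).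
move=> mB; apply/esym.
apply: (@measure_eq_on_rectangles P (pushforward (P \x U)%E f)) => //.
  by rewrite /= probability_setT ltry.
move=> _ [n [A [mA ->]]].
rewrite -[RHS]/((P \x U)%E (resample i @^-1` rectangle n A)).
rewrite preimage_resample_rectangle product_measure1E; last 2 first.
- by apply: measurable_rectangle => k; case: ifP.
- by case: ifP.
rewrite [X in (X * _)%E]prob_rectangle; last by move=> k; case: ifP.
rewrite [LHS]prob_rectangle//.
case: ltnP => [lt_in|le_ni].
  rewrite (bigD1 (Ordinal lt_in))//= [in RHS](bigD1 (Ordinal lt_in))//= eqxx.
  rewrite [X in (X * _ * _)%E]probability_setT mul1e muleC; congr (_ * _)%E.
  by apply: eq_bigr => k; rewrite -val_eqE /= => /negbTE ->.
rewrite [X in (_ * X)%E]probability_setT mule1; apply: eq_bigr => k _.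
by rewrite ltn_eqF// (leq_trans (ltn_ord k)).
Qed.

Lemma Rintegral_resample i (G : T -> R) : bounded_mfun G ->
  \int[P]_t G t = \int[P]_t \int[U]_s G (resample i (t, s)).
Proof.
move=> Gb; have Gib := bounded_mfun_comp (measurable_resample i) Gb.
rewrite (Rintegral12_prod U Gib P); congr fine.
rewrite -[RHS](@integral_pushforward _ _ _ _ R _ (measurable_resample i)
  (P \x U)%E setT (EFin \o G))//.
- apply/esym/eq_measure_integral => [|mf B mB _]; first exact: measurable_resample.
  exact: pushforward_resample.
- by apply/measurable_EFinP; case: Gb.
- exact: bounded_mfun_prod_integrable.
Qed.

End InfiniteProduct.

Section Telescoping.
Variable R : realType.
Local Notation torus := (measurableTypeR R).
Local Notation U := (torus_prob R).
Local Notation T := (Tinf R).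
Variables (P : probability T R) (X : nat -> R -> R) (N : nat -> nat).
Variables (n : nat) (kappa : R).
Hypothesis P_prod : is_infinite_product P.
Hypotheses (X_cont : forall k, continuous (X k)) (X_ge0 : forall k x, 0 <= X k x).
Hypothesis N_gt0 : forall k, (0 < N k)%N.
Hypothesis X_per : forall k, periodic (X k) (2 * pi / (N k)%:R).

Let head i (x : R) := \sum_(k < i) X k x.
Let tail i (t : T) := \sum_(i <= k < n) X k (t k).

Hypothesis head_level : forall i, (i < n)%N ->
  exists2 K, indicatrix_le K (head i) & K%:R <= kappa * (N i)%:R.

Let mixed i t := \int[U]_x Num.sqrt (head i x + tail i t).

Let X2pi k : periodic (X k) (2 * pi).
Proof. exact: periodic_mesh (N_gt0 k) (X_per k). Qed.

Let X_bmf k : bounded_mfun (X k : torus -> R).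
Proof. exact: continuous_periodic_bounded_mfun. Qed.

Let head_cont i : continuous (head i).
Proof.
move=> x; apply: cvg_big => [|k _]; first exact: add_continuous.
exact: X_cont.
Qed.

Let head2pi i : periodic (head i) (2 * pi).
Proof. by move=> x; apply: eq_bigr => k _; rewrite X2pi. Qed.

Let head_ge0 i x : 0 <= head i x. Proof. exact: sumr_ge0. Qed.
Let tail_ge0 i t : 0 <= tail i t. Proof. exact: sumr_ge0. Qed.

Let tail_bmf i : bounded_mfun (tail i).
Proof.
by apply: bounded_mfun_sum => k; exact: bounded_mfun_comp (measurable_coord k) _.
Qed.

Let sqrt_tail_bmf i : bounded_mfun (fun t => Num.sqrt (tail i t)).
Proof. exact: bounded_mfun_sqrt. Qed.

Let mixed_bmf i : bounded_mfun (mixed i).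
Proof.
apply: (bounded_mfun_Rintegral U
  (f := fun tx : T * torus => Num.sqrt (head i tx.2 + tail i tx.1))).
apply/bounded_mfun_sqrt/bounded_mfunD.
  apply: (bounded_mfun_comp (f := head i : torus -> R)) measurable_snd _.
  exact: continuous_periodic_bounded_mfun.
exact: bounded_mfun_comp measurable_fst (tail_bmf i).
Qed.

Let average_bmf i (G : T -> R) : bounded_mfun G ->
  bounded_mfun (fun t => \int[U]_s G (resample i (t, s))).
Proof.
move=> Gb; apply: (bounded_mfun_Rintegral U (f := fun ts => G (resample i ts))).
exact: bounded_mfun_comp (measurable_resample i) Gb.
Qed.

Let tail_resample i t s : (i < n)%N ->
  tail i (resample i (t, s)) = tail i.+1 t + X i s.
Proof.
move=> ilt; rewrite /tail big_ltn// {1}/resample eqxx addrC; congr (_ + _).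
apply: eq_big_nat => k /andP[ik _]; congr (X k _).
by rewrite /resample gtn_eqF.
Qed.

Let mixedS i t :
  mixed i.+1 t = \int[U]_x Num.sqrt (head i x + tail i.+1 t + X i x).
Proof.
by apply: eq_Rintegral => x _; rewrite /head big_ord_recr /= addrAC.
Qed.

Let mixed_resample i t s : (i < n)%N -> mixed i (resample i (t, s))
  = \int[U]_x Num.sqrt (head i x + tail i.+1 t + X i s).
Proof. by move=> ilt; apply: eq_Rintegral => x _; rewrite tail_resample// addrA. Qed.

Lemma mixed_step_le i : (i < n)%N ->
  `|\int[P]_t mixed i.+1 t - \int[P]_t mixed i t|
  <= kappa * (\int[P]_t Num.sqrt (tail i t) - \int[P]_t Num.sqrt (tail i.+1 t)).
Proof.
move=> ilt; have [K hK KN] := head_level ilt.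
rewrite [X in _ - X](Rintegral_resample P_prod i)//.
rewrite [X in _ <= _ * (X - _)](Rintegral_resample P_prod i)//.
have avg_mixed := average_bmf i (mixed_bmf i).
have avg_sqrt_tail := average_bmf i (sqrt_tail_bmf i).
rewrite -[X in _ <= _ * X]Rintegral_bounded_mfunB// -RintegralZl//; last first.
  exact/bounded_mfun_prob_integrable/bounded_mfunB.
apply: dist_Rintegral_le => // [|t]; first exact/bounded_mfunZ/bounded_mfunB.
rewrite mixedS; under [X in `|_ - X|]eq_Rintegral do rewrite mixed_resample//.
under [X in _ <= _ * (X - _)]eq_Rintegral do rewrite tail_resample//.
exact: (sqrt_decoupling _ _ _ hK).
Qed.

Lemma sqrt_sum_decoupling :
  `|\int[U]_x Num.sqrt (\sum_(k < n) X k x)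
      - \int[P]_t Num.sqrt (\sum_(k < n) X k (t k))|
  <= kappa * \int[P]_t Num.sqrt (\sum_(k < n) X k (t k)).
Proof.
pose J i := \int[P]_t mixed i t; pose W i := \int[P]_t Num.sqrt (tail i t).
have Jn : J n = \int[U]_x Num.sqrt (\sum_(k < n) X k x).
  rewrite -[RHS](Rintegral_prob_cst P); apply: eq_Rintegral => t _.
  by apply: eq_Rintegral => x _; rewrite /tail big_geq// addr0.
have W0 : W 0 = \int[P]_t Num.sqrt (\sum_(k < n) X k (t k)).
  by apply: eq_Rintegral => t _; rewrite /tail big_mkord.
have J0 : J 0 = W 0.
  apply: eq_Rintegral => t _; rewrite -[RHS](Rintegral_prob_cst U).
  by apply: eq_Rintegral => x _; rewrite /head big_ord0 add0r.
have Wn : W n = 0.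
  rewrite -[RHS](Rintegral_prob_cst P); apply: eq_Rintegral => t _.
  by rewrite /tail big_geq// sqrtr0.
suff : `|J n - J 0| <= kappa * (W 0 - W n) by rewrite Jn J0 Wn W0 subr0.
rewrite -(telescope_sumr J (leq0n n)) -opprB -(telescope_sumr W (leq0n n)) -sumrN.
rewrite mulr_sumr; apply: (le_trans (ler_norm_sum _ _ _)); apply: ler_sum_nat => i.
by move=> /andP[_ ilt]; rewrite opprB; exact: mixed_step_le.
Qed.

End Telescoping.

Section Truncation.
Variable R : realType.

Lemma sqrt_sum_homo (u : nat -> R) m n : (forall k, 0 <= u k) -> (m <= n)%N ->
  Num.sqrt (\sum_(k < m) u k) <= Num.sqrt (\sum_(k < n) u k).
Proof.
move=> u0 mn; rewrite ler_wsqrtr// -!(big_mkord xpredT u) (big_cat_nat _ mn)//=.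
by rewrite lerDl sumr_ge0.
Qed.

Lemma l2_at_cvg (g : nat -> R[i]) :
  (Num.sqrt (\sum_(k < n) sqmod (g k)))%:E @[n --> \oo] --> l2_at g.
Proof.
rewrite /l2_at; set S := (\sum_(0 <= k <oo) _)%E.
have S0 : (0 <= S)%E by apply: nneseries_ge0 => k _ _; rewrite lee_fin sqmod_ge0.
have partial_cvg : (\sum_(k < n) sqmod (g k))%:E @[n --> \oo] --> S.
  under eq_fun do rewrite -sumEFin -(big_mkord xpredT (fun k => (sqmod (g k))%:E)).
  by apply: is_cvg_nneseries => k _ _; rewrite lee_fin sqmod_ge0.
move: S S0 partial_cvg => [s| |] //= _ partial_cvg.
  apply/cvg_EFin; first by near=> n.
  apply: (cvg_comp (fun n => \sum_(k < n) sqmod (g k)) Num.sqrt).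
    exact: fine_cvg partial_cvg.
  exact: sqrt_continuous.
apply/cvgeryP/cvgryPge => B; have /cvgeryP/cvgryPge := partial_cvg.
move=> /(_ (B ^+ 2)); apply: filterS => n B_le.
by rewrite (le_trans (ler_norm B))// -sqrtr_sqr ler_wsqrtr.
Unshelve. all: by end_near. Qed.

Context d (T : measurableType d) (mu : {measure set T -> \bar R}) (D : set T).
Variable g : nat -> T -> R[i].
Hypothesis mD : measurable D.
Hypothesis mg : forall k, measurable_fun D (fun x => sqmod (g k x)).

Let trunc n x := (Num.sqrt (\sum_(k < n) sqmod (g k x)))%:E.

Let measurable_trunc n : measurable_fun D (trunc n).
Proof.
apply/measurable_EFinP.
apply: (measurableT_comp (continuous_measurable_fun (@sqrt_continuous R))).
exact: measurable_sum.
Qed.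

Let trunc_homo m n x : (m <= n)%N -> (trunc m x <= trunc n x)%E.
Proof.
by move=> mn; rewrite lee_fin (sqrt_sum_homo (u := fun k => sqmod (g k x)))// => k;
  exact: sqmod_ge0.
Qed.

Lemma integral_l2_at_cvg :
  (\int[mu]_(x in D) (Num.sqrt (\sum_(k < n) sqmod (g k x)))%:E)%E @[n --> \oo]
    --> (\int[mu]_(x in D) l2_at (g^~ x))%E.
Proof.
have -> : (\int[mu]_(x in D) l2_at (g^~ x) = \int[mu]_(x in D) limn (trunc^~ x))%E.
  by apply: eq_integral => x _; apply/esym/cvg_lim => //; exact: l2_at_cvg.
apply: cvg_monotone_convergence => // x _ m n; exact: trunc_homo.
Qed.

Lemma integral_sqrt_sum_le n :
  (\int[mu]_(x in D) (Num.sqrt (\sum_(k < n) sqmod (g k x)))%:E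
    <= \int[mu]_(x in D) l2_at (g^~ x))%E.
Proof.
apply: (cvge_to_ge integral_l2_at_cvg); near=> m.
have nm : (n <= m)%N by near: m; exact: nbhs_infty_ge.
apply: ge0_le_integral => //.
- exact: measurable_trunc.
- exact: measurable_trunc.
- by move=> x _; exact: trunc_homo.
Unshelve. all: by end_near. Qed.

End Truncation.

Section Decoupling.
Variable R : realType.
Local Notation torus := (measurableTypeR R).
Local Notation U := (torus_prob R).
Variables (N d : nat -> nat) (f : nat -> R -> R[i]) (P : probability (Tinf R) R).
Hypothesis N_gt0 : forall k, (0 < N k)%N.
Hypothesis N_homo : {homo N : m n / (m <= n)%N}.
Hypothesis f_deg : forall k, trig_poly_deg_le (d k) (f k).
Hypothesis f_per : forall k t, f k (t + 2 * pi / (N k)%:R) = f k t.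
Hypothesis P_prod : is_infinite_product P.

Let X k x := sqmod (f k x).
Let torus_norm n := \int[U]_x Num.sqrt (\sum_(k < n) X k x).
Let prod_norm n := \int[P]_t Num.sqrt (\sum_(k < n) X k (t k)).

Let X_per k : periodic (X k) (2 * pi / (N k)%:R).
Proof. by move=> x; rewrite /X f_per. Qed.

Let X_cont k : continuous (X k).
Proof. exact: continuous_Re_trig_poly (trig_poly_deg_le_sqmod (f_deg k)). Qed.

Let X_bmf k : bounded_mfun (X k : torus -> R).
Proof.
apply: continuous_periodic_bounded_mfun => //.
exact: periodic_mesh (N_gt0 k) (X_per k).
Qed.

Let X_coord_bmf k : bounded_mfun (fun t : Tinf R => X k (t k)).
Proof. exact: bounded_mfun_comp (measurable_coord k) (X_bmf k). Qed.

Lemma truncated_decoupling (theta : R) n :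
  0 <= theta -> (forall k, (k < n)%N -> (d k)%:R <= theta * (N k.+1)%:R) ->
  `|torus_norm n - prod_norm n| <= 4 * theta * prod_norm n.
Proof.
move=> theta0 d_le; apply: (sqrt_sum_decoupling P_prod X_cont _ N_gt0 X_per).
  by move=> k x; exact: sqmod_ge0.
move=> i lt_in; exists (4 * \max_(k < i) d k)%N.
  apply: (indicatrix_le_sum_sqmod (d := d)) => // k ki.
  exact: (leq_bigmax (F := fun k : 'I_i => d k) (Ordinal ki)).
rewrite natrM -mulrA ler_pM2l//.
apply: (big_ind (fun m => m%:R <= theta * (N i)%:R)) => [|m m'|k _].
- by rewrite mulr_ge0.
- by rewrite natr_max ge_max => -> ->.
- rewrite (le_trans (d_le k (ltn_trans (ltn_ord k) lt_in)))//.
  by rewrite ler_wpM2l// ler_nat N_homo.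
Qed.

Lemma torus_norm_cvg : (torus_norm n)%:E @[n --> \oo] --> L1l2_norm f.
Proof.
have torus_normE n : (torus_norm n)%:E
    = (((2 * pi)^-1)%:E * \int[lebesgue_measure]_(x in @I2pi R)
        (Num.sqrt (\sum_(k < n) sqmod (f k x)))%:E)%E.
  have sqrt_bmf : bounded_mfun (fun x : torus => Num.sqrt (\sum_(k < n) X k x)).
    exact/bounded_mfun_sqrt/bounded_mfun_sum.
  rewrite EFin_Rintegral// integral_torus//.
  by apply/measurable_EFinP; case: sqrt_bmf.
under eq_fun do rewrite torus_normE.
apply: cvgeZl => //; apply: integral_l2_at_cvg => [|k]; first exact: measurable_itv.
by apply: measurable_funTS; case: (X_bmf k).
Qed.

Let EFin_prod_norm n : (prod_norm n)%:E
  = (\int[P]_t (Num.sqrt (\sum_(k < n) sqmod (f k (t k))))%:E)%E.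
Proof. by apply/EFin_Rintegral/bounded_mfun_sqrt/bounded_mfun_sum. Qed.

Let measurable_X_coord k : measurable_fun setT (fun t : Tinf R => sqmod (f k (t k))).
Proof. by case: (X_coord_bmf k). Qed.

Lemma prod_norm_cvg : (prod_norm n)%:E @[n --> \oo] --> ind_norm P f.
Proof.
under eq_fun do rewrite EFin_prod_norm.
exact: (integral_l2_at_cvg (g := fun k (t : Tinf R) => f k (t k)) measurableT).
Qed.

Lemma prod_norm_le n : ((prod_norm n)%:E <= ind_norm P f)%E.
Proof.
rewrite EFin_prod_norm.
exact: (integral_sqrt_sum_le (g := fun k (t : Tinf R) => f k (t k)) P measurableT).
Qed.

Let torus_norm_ge0 n : 0 <= torus_norm n.
Proof. by apply: Rintegral_ge0 => x _; exact: sqrtr_ge0. Qed.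

Let prod_norm_ge0 n : 0 <= prod_norm n.
Proof. by apply: Rintegral_ge0 => x _; exact: sqrtr_ge0. Qed.

Variable theta : \bar R.
Hypothesis ratio_le : forall k, (((d k)%:R / (N k.+1)%:R)%:E <= theta)%E.

Let theta_ge0 : (0 <= theta)%E.
Proof. by apply: le_trans (ratio_le 0); rewrite lee_fin divr_ge0. Qed.

Lemma truncated_bounds n :
  ((1 - 4%:E * theta) * (prod_norm n)%:E <= (torus_norm n)%:E)%E /\
  ((torus_norm n)%:E <= (1 + 4%:E * theta) * (prod_norm n)%:E)%E.
Proof.
pose r := \big[Num.max/0]_(k < n) ((d k)%:R / (N k.+1)%:R : R).
have r_le : (4%:E * r%:E <= 4%:E * theta)%E.
  rewrite lee_pmul2l//; apply: (big_ind (fun x => x%:E <= theta)%E) => // x y x_le y_le.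
  by rewrite EFin_max ge_max x_le y_le.
have : `|torus_norm n - prod_norm n| <= 4 * r * prod_norm n.
  apply: truncated_decoupling => [|k kn]; first exact: bigmax_ge_id.
  rewrite -ler_pdivrMr ?ltr0n//.
  exact: (le_bigmax _ (fun k : 'I_n => (d k)%:R / (N k.+1)%:R) (Ordinal kn)).
rewrite ler_distl => /andP[lower upper]; split.
  apply: (@le_trans _ _ ((1 - 4%:E * r%:E) * (prod_norm n)%:E)%E).
    by rewrite lee_wpmul2r ?lee_fin// leeB.
  by rewrite -EFinM lee_fin mulrBl mul1r.
apply: (@le_trans _ _ ((1 + 4%:E * r%:E) * (prod_norm n)%:E)%E).
  by rewrite -EFinM lee_fin mulrDl mul1r.
by rewrite lee_wpmul2r ?lee_fin// leeD2l.
Qed.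

Let ind_norm_ge0 : (0 <= ind_norm P f)%E.
Proof. by apply: le_trans (prod_norm_le 0); rewrite lee_fin. Qed.

Lemma L1l2_norm_le : (L1l2_norm f <= (1 + 4%:E * theta) * ind_norm P f)%E.
Proof.
apply: (cvge_to_le torus_norm_cvg); apply: nearW => n.
apply: le_trans (truncated_bounds n).2 _; apply: lee_wpmul2l; last exact: prod_norm_le.
by rewrite adde_ge0// mule_ge0.
Qed.

Lemma L1l2_norm_ge : ((1 - 4%:E * theta) * ind_norm P f <= L1l2_norm f)%E.
Proof.
have [factor_ge0|/ltW factor_le0] := leP 0%E (1 - 4%:E * theta)%E; last first.
  apply: (@le_trans _ _ 0%E); first exact: mule_le0_ge0.
  by apply: (cvge_to_ge torus_norm_cvg); apply: nearW => n; rewrite lee_fin.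
have factor_fin : (1 - 4%:E * theta)%E \is a fin_num.
  rewrite ge0_fin_numE//; apply: (@le_lt_trans _ _ 1%E); last exact: ltry.
  by rewrite -[leRHS]sube0 leeB// mule_ge0.
apply: (lee_cvg_to (cvgeZl factor_fin prod_norm_cvg) torus_norm_cvg).
by apply: nearW => n; exact: (truncated_bounds n).1.
Qed.

End Decoupling.

(* Indices k = 0,1,2,... correspond to the paper's k = 1,2,3,... *)
Theorem theorem5p8 (R : realType) :
  exists C : R, 0 < C /\
  forall (N d : nat -> nat) (f : nat -> R -> R[i])
         (P : probability (Tinf R) R),
    (forall k, (0 < N k)%N) ->
    (forall k, (N k %| N k.+1)%N) ->
    (forall k, (0 < d k)%N) ->
    (forall k, trig_poly_deg_le (d k) (f k)) ->
    (forall k t, f k (t + 2 * pi / (N k)%:R) = f k t) ->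
    is_infinite_product P ->
    let theta : \bar R :=
      ereal_sup [set ((d k)%:R / (N k.+1)%:R)%:E | k in [set: nat]] in
    ((1%E - C%:E * theta) * ind_norm P f <= L1l2_norm f)%E /\
    (L1l2_norm f <= (1%E + C%:E * theta) * ind_norm P f)%E.
Proof.
exists 4; split=> // N d f P N_gt0 N_dvd _ f_deg f_per P_prod theta.
have ratio_le k : (((d k)%:R / (N k.+1)%:R)%:E <= theta)%E.
  by apply: ereal_sup_ubound; exists k.
have N_homo : {homo N : m n / (m <= n)%N}.
  by apply: homo_leq => // [k m n|k]; [exact: leq_trans|exact: dvdn_leq].
split; first exact: (L1l2_norm_ge N_gt0 N_homo f_deg f_per P_prod ratio_le).
exact: (L1l2_norm_le N_gt0 N_homo f_deg f_per P_prod ratio_le).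
Qed.
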